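(* Let $\mathcal{D}(F)$ be convex, for $\delta>0$ let $y^\delta\in\mathcal{Y}$ satisfy $\|y-y^\delta\|_{\mathcal{Y}}\le\delta$, and let $x^\dagger$ be an $x^*$-$\mathcal{S}$-minimum-norm solution. Moreover, let the following conditions hold: (i) $F$ is Fréchet-differentiable (with derivative $F'(x):L^2(\Omega)\to\mathcal{Y}$ at $x\in\mathcal{D}(F)$); (ii) there exists $\gamma\ge0$ such that $\|F'(x^\dagger)-F'(x)\|\le\gamma\|x^\dagger-x\|_2$ (operator norm on the left) for all $x\in\mathcal{D}(F)$ in a sufficiently large ball around $x^\dagger$, i.e. for all $x\in\mathcal{D}(F)$ with $\|x-x^\dagger\|_2<\rho$ for some $\rho>2\|x^\dagger-x^*\|_2$; (iii) there exists $\omega\in\mathcal{Y}$ satisfying $x^\dagger-x^*=F'(x^\dagger)^*\omega$, where $F'(x^\dagger)^*:\mathcal{Y}\to L^2(\Omega)$ is the Hilbert space adjoint; and (iv) $\gamma\|\omega\|_{\mathcal{Y}}<1$. Let $x_\alpha^\delta$ denote a solution of $$\min_{x\in\mathcal{D}(F)}\left\{\|F(x)-y^\delta\|_{\mathcal{Y}}^2+\|x-x^*\|_{\mathcal{S},\alpha}^2\right\}.$$ Then for the choice $\alpha\sim\delta$ (i.e. $c_1\delta\le\alpha=\alpha(\delta)\le c_2\delta$ with constants $c_1,c_2>0$), one has, as $\delta\to0$, $$\|x_\alpha^\delta-x^\dagger\|_{\mathcal{S}^+,2}=O(\sqrt{\delta}),\qquad \|x_\alpha^\delta-x^\dagger\|_{\mathcal{S}^-,2}=O(\delta),\qquad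 \|F(x_\alpha^\delta)-y\|_{\mathcal{Y}}=O(\delta).$$
   Context: Setting. $\Omega\subset\mathbb{R}^n$ is measurable and bounded, $\mathcal{Y}$ is a Hilbert space, and $F:\mathcal{D}(F)\subset L^2(\Omega)\to\mathcal{Y}$ is a (possibly nonlinear) operator which is continuous and weakly sequentially closed, i.e. if $x_n\in\mathcal{D}(F)$, $x_n\rightharpoonup x$ in $L^2(\Omega)$ and $F(x_n)\rightharpoonup z$ in $\mathcal{Y}$, then $x\in\mathcal{D}(F)$ and $F(x)=z$. $\|\cdot\|_2$ is the $L^2(\Omega)$-norm. $\mathcal{S}\subset\Omega$ is a measurable set; for $x\in L^2(\Omega)$, ''$\mathrm{supp}(x)\subset\mathcal{S}$'' means $x=0$ almost everywhere on $\Omega\setminus\mathcal{S}$. The initial guess $x^*\in L^2(\Omega)$ satisfies $\mathrm{supp}(x^* )\subset\mathcal{S}$. The exact data $y\in\mathcal{Y}$ are fixed and such that $F(x)=y$ has a solution $x\in\mathcal{D}(F)$ with $\mathrm{supp}(x)\subset\mathcal{S}$. An $x^*$-$\mathcal{S}$-minimum-norm solution is any minimizer of $\|x-x^*\|_2$ over the set of all $x\in\mathcal{D}(F)$ with $F(x)=y$ and $\mathrm{supp}(x)\subset\mathcal{S}$. For $\alpha>0$ and $x\in L^2(\Omega)$, define $$\|x\|_{\mathcal{S}^+,2}:=\left(\int_{\mathcal{S}}|x(\lambda)|^2\,d\lambda\right)^{1/2},\qquad \|x\|_{\mathcal{S}^-,2}:=\left(\int_{\Omega\setminus\mathcal{S}}|x(\lambda)|^2\,d\lambda\right)^{1/2},$$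 $$\|x\|_{\mathcal{S},\alpha}:=\left(\alpha\|x\|_{\mathcal{S}^+,2}^2+\|x\|_{\mathcal{S}^-,2}^2\right)^{1/2}.$$ *)

(* Defs.v *)
From HB Require Import structures.
From mathcomp Require Import all_boot all_order all_algebra.
From mathcomp Require Import all_classical all_reals all_analysis.
From mathcomp Require Import measurable_realfun ess_sup_inf.

Set Implicit Arguments.
Unset Strict Implicit.
Unset Printing Implicit Defensive.

Import Order.TTheory GRing.Theory Num.Theory.
Import numFieldNormedType.Exports.

Local Open Scope classical_set_scope.
Local Open Scope ring_scope.

HB.mixin Record NormedModule_isInnerProduct (R : realType) V
    & NormedModule R V := {
  dot : V -> V -> R ;
  dotC : forall x y, dot x y = dot y x ;
  dotDZl : forall (a : R) x y z, dot (a *: x + y) z = a * dot x z + dot y z ;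
  dotxx : forall x, dot x x = `|x| ^+ 2
}.

#[short(type=innerProductType)]
HB.structure Definition InnerProduct (R : realType) :=
  {V of NormedModule R V & NormedModule_isInnerProduct R V}.

#[short(type=hilbertType)]
HB.structure Definition Hilbert (R : realType) :=
  {V of InnerProduct R V & Complete V}.

Lemma ae_eq_Lnorm d (T : measurableType d) (R : realType)
    (mu : {measure set T -> \bar R}) (p : \bar R) (f g : T -> R) :
  measurable_fun setT f -> measurable_fun setT g -> f = g %[ae mu] ->
  'N[mu]_p[EFin \o f]%E = 'N[mu]_p[EFin \o g]%E.
Proof.
move=> mf mg fg; rewrite unlock; case: p => [r||].
- congr (_ `^ _)%E; apply: ge0_ae_eq_integral => //=.

  + apply/measurable_EFinP; apply: (@measurableT_comp _ _ _ _ _ _ (@powR R ^~ r)) => //.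
    exact: measurableT_comp.
  + apply/measurable_EFinP; apply: (@measurableT_comp _ _ _ _ _ _ (@powR R ^~ r)) => //.
    exact: measurableT_comp.
  + by apply: filterS fg => x /(_ I) fgx _; rewrite /= fgx.
- case: ifPn => // _; apply: eq_ess_sup.
  by apply: filterS fg => x /(_ I) fgx; rewrite /= ?fgx.
- case: ifPn => // _; apply: eq_ess_inf.
  by apply: filterS fg => x /(_ I) fgx; rewrite /= ?fgx.
Qed.

(* The library provides the set of a.e. classes LspaceType but no algebraic
   structure on it; the vector space structure is transported from the
   functions LfunType along class / representative, and the norm is 'N[mu]_p. *)
Section Lspace_vector.
Local Open Scope quotient_scope.
Context d (T : measurableType d) (R : realType).
Variable mu : {measure set T -> \bar R}.
Variables (p : \bar R) (p1 : (1 <= p)%E).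
Local Notation L := (LspaceType mu p1).
Local Notation F := (LfunType mu p1).
Local Notation M := {mfun_ mu, T >-> measurableTypeR R}.

Lemma Lspace_Lfun (x : L) : (x : T -> R) \in Lfun mu p.
Proof.
rewrite inE; apply/andP; split; rewrite inE.
  exact: (@measurable_funPT _ _ _ _ (repr (x : M))).
exact: Lebesgue_finite.
Qed.

Definition Lfun_of_Lspace (x : L) : F := Lfun_Sub p1 (Lspace_Lfun x).

Definition mfun_of_Lfun (f : F) : {mfun T >-> measurableTypeR R} :=
  @mfun_Sub _ _ T (measurableTypeR R) f (mem_set (@measurable_funPT _ _ _ _ f)).

Definition class_of_Lfun (f : F) : M := \pi_M (mfun_of_Lfun f).

Lemma class_of_LfunE (f : F) : (class_of_Lfun f : T -> R) = f %[ae mu].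
Proof.
have /eqmodP/asboolP : \pi_M (repr (class_of_Lfun f)) = \pi_M (mfun_of_Lfun f).
  by rewrite reprK.
exact.
Qed.

Lemma class_of_Lfun_finite (f : F) : finite_norm mu p (class_of_Lfun f).
Proof.
rewrite /finite_norm (ae_eq_Lnorm p _ _ (class_of_LfunE f))//.
  exact: Lfunction_finite.
exact: (@measurable_funPT _ _ _ _ (repr (class_of_Lfun f))).
Qed.

HB.instance Definition _ (f : F) :=
  isFinLebesgue.Build d T R mu p p1 (class_of_Lfun f) (class_of_Lfun_finite f).

Definition Lspace_of_Lfun (f : F) : L := class_of_Lfun f.

Lemma Lspace_of_LfunE (f : F) : (Lspace_of_Lfun f : T -> R) = f %[ae mu].
Proof. exact: class_of_LfunE. Qed.

Lemma LspaceP (x y : L) : (x : T -> R) = y %[ae mu] -> x = y.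
Proof.
case: x y => [x [[xf]]] [y [[yf]]] /= xy.
have exy : x = y.
  rewrite -[x]reprK -[y]reprK; apply/eqmodP/asboolP; exact: xy.
by move: xf yf xy; rewrite exy => xf yf _; rewrite (Prop_irrelevance xf yf).
Qed.

Lemma Lspace_of_LfunP (f g : F) : (f : T -> R) = g %[ae mu] ->
  Lspace_of_Lfun f = Lspace_of_Lfun g.
Proof.
move=> fg; apply: LspaceP; apply: ae_eq_trans (Lspace_of_LfunE f) _.
apply: ae_eq_trans fg _; exact/ae_eq_sym/Lspace_of_LfunE.
Qed.

Lemma Lfun_of_LspaceK : cancel Lfun_of_Lspace Lspace_of_Lfun.
Proof. by move=> x; apply: LspaceP; exact: Lspace_of_LfunE. Qed.

HB.instance Definition _ := gen_eqMixin L.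
HB.instance Definition _ := gen_choiceMixin L.

Definition Lspace_add (x y : L) : L :=
  Lspace_of_Lfun (Lfun_of_Lspace x + Lfun_of_Lspace y).
Definition Lspace_opp (x : L) : L := Lspace_of_Lfun (- Lfun_of_Lspace x).
Definition Lspace_scale (a : R) (x : L) : L :=
  Lspace_of_Lfun (a *: Lfun_of_Lspace x).

Lemma Lspace_of_LfunD (f g : F) :
  Lspace_of_Lfun (f + g) = Lspace_add (Lspace_of_Lfun f) (Lspace_of_Lfun g).
Proof.
apply: Lspace_of_LfunP.
have := Lspace_of_LfunE f; have := Lspace_of_LfunE g.
by apply: filterS2 => t /(_ I) /= fE /(_ I) /= gE _; congr (_ + _).
Qed.

Lemma Lspace_of_LfunN (f : F) :
  Lspace_of_Lfun (- f) = Lspace_opp (Lspace_of_Lfun f).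
Proof.
apply: Lspace_of_LfunP; have := Lspace_of_LfunE f.
by apply: filterS => t /(_ I) /= fE _; congr (- _).
Qed.

Lemma Lspace_of_LfunZ a (f : F) :
  Lspace_of_Lfun (a *: f) = Lspace_scale a (Lspace_of_Lfun f).
Proof.
apply: Lspace_of_LfunP; have := Lspace_of_LfunE f.
by apply: filterS => t /(_ I) /= fE _; congr (_ *: _).
Qed.

Let addA : associative Lspace_add.
Proof.
move=> x y z; rewrite -(Lfun_of_LspaceK x) -(Lfun_of_LspaceK y).
by rewrite -(Lfun_of_LspaceK z) -!Lspace_of_LfunD addrA.
Qed.

Let addC : commutative Lspace_add.
Proof. by move=> x y; rewrite /Lspace_add addrC. Qed.

Let add0 : left_id (Lspace_of_Lfun 0) Lspace_add.
Proof. by move=> x; rewrite -(Lfun_of_LspaceK x) -!Lspace_of_LfunD add0r. Qed.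

Let addN : left_inverse (Lspace_of_Lfun 0) Lspace_opp Lspace_add.
Proof.
by move=> x; rewrite -(Lfun_of_LspaceK x) -Lspace_of_LfunN -Lspace_of_LfunD addNr.
Qed.

HB.instance Definition _ := GRing.isZmodule.Build L addA addC add0 addN.

Let scaleA a b x : Lspace_scale a (Lspace_scale b x) = Lspace_scale (a * b) x.
Proof. by rewrite -(Lfun_of_LspaceK x) -!Lspace_of_LfunZ scalerA. Qed.

Let scale1 : left_id 1 Lspace_scale.
Proof. by move=> x; rewrite -(Lfun_of_LspaceK x) -!Lspace_of_LfunZ scale1r. Qed.

Let scaleDr : right_distributive Lspace_scale +%R.
Proof.
move=> a x y; rewrite -(Lfun_of_LspaceK x) -(Lfun_of_LspaceK y).
rewrite -[LHS]/(Lspace_scale _ (Lspace_add _ _)).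
by rewrite -!(Lspace_of_LfunD, Lspace_of_LfunZ) scalerDr Lspace_of_LfunD.
Qed.

Let scaleDl x : {morph Lspace_scale^~ x : a b / a + b}.
Proof.
move=> a b; rewrite -(Lfun_of_LspaceK x).
by rewrite -!Lspace_of_LfunZ scalerDl Lspace_of_LfunD.
Qed.

HB.instance Definition _ :=
  GRing.Zmodule_isLmodule.Build R L scaleA scale1 scaleDr scaleDl.

Lemma Lspace_addE (x y : L) : (x + y : T -> R) = (fun t => x t + y t) %[ae mu].
Proof. exact: Lspace_of_LfunE. Qed.

Lemma Lspace_scaleE a (x : L) : (a *: x : T -> R) = (fun t => a * x t) %[ae mu].
Proof. exact: Lspace_of_LfunE. Qed.

Definition Lspace_norm (x : L) : R := fine ('N[mu]_p[EFin \o x])%E.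

Lemma Lspace_norm_Lfun (f : F) :
  Lspace_norm (Lspace_of_Lfun f) = fine ('N[mu]_p[EFin \o f])%E.
Proof.
rewrite /Lspace_norm (ae_eq_Lnorm p _ _ (Lspace_of_LfunE f))//.
exact: (@measurable_funPT _ _ _ _ (repr (class_of_Lfun f))).
Qed.

Let normD x y : Lspace_norm (x + y) <= Lspace_norm x + Lspace_norm y.
Proof.
rewrite -(Lfun_of_LspaceK x) -(Lfun_of_LspaceK y) -[_ + _]Lspace_of_LfunD.
by rewrite !Lspace_norm_Lfun; exact: ler_LnormD.
Qed.

Let normZ a x : Lspace_norm (a *: x) = `|a| * Lspace_norm x.
Proof.
rewrite -(Lfun_of_LspaceK x) -[_ *: _]Lspace_of_LfunZ !Lspace_norm_Lfun.
by rewrite (LnormZ (Lfun_of_Lspace x) a) -finite_norm_fine.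
Qed.

Let norm0 x : Lspace_norm x = 0 -> x = 0.
Proof.
rewrite -(Lfun_of_LspaceK x) Lspace_norm_Lfun => /fine_Lnormr_eq0 x0.
exact: Lspace_of_LfunP.
Qed.

HB.instance Definition _ :=
  Lmodule_isNormed.Build R L normD normZ norm0.

End Lspace_vector.

Section L2_dot.
Context d (T : measurableType d) (R : realType).
Variable mu : {measure set T -> \bar R}.
Local Notation L := (LspaceType mu (lee1n 2)).

Definition L2_dot (x y : L) : R := \int[mu]_t (x t * y t).

Let L2_Lfun (x : L) : (x : T -> R) \in Lfun mu 2%:E.
Proof. exact: Lspace_Lfun. Qed.

Let mL2 (x : L) : measurable_fun setT (x : T -> R).
Proof.
exact: (@measurable_funPT _ _ _ _ (repr (x : {mfun_ mu, T >-> measurableTypeR R}))).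
Qed.

Lemma L2_mul_integrable (x y : L) :
  mu.-integrable setT (EFin \o (fun t => x t * y t)).
Proof. by apply/Lfun1_integrable; exact: Lfun2_mul_Lfun1. Qed.

Let dotC (x y : L) : L2_dot x y = L2_dot y x.
Proof. by apply: eq_Rintegral => t _; rewrite mulrC. Qed.

Let dotDZl (a : R) (x y z : L) :
  L2_dot (a *: x + y) z = a * L2_dot x z + L2_dot y z.
Proof.
rewrite /L2_dot -RintegralZl//; last exact: L2_mul_integrable.
rewrite -RintegralD//; first last.
- exact: L2_mul_integrable.
- have -> : EFin \o (fun t => a * (x t * z t)) =
            (fun t => a%:E * (x t * z t)%R%:E)%E.
    by apply/funext => t /=; rewrite EFinM.
  by apply: integrableZl => //; exact: L2_mul_integrable.
congr fine; apply: ae_eq_integral => //.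
- by apply/measurable_EFinP; apply: measurable_funM.
- apply/measurable_EFinP; apply: measurable_funD; apply: measurable_funM => //.
  exact: measurable_funM.
have := Lspace_addE (a *: x) y; have := Lspace_scaleE a x.
apply: filterS2 => t /(_ I) /= axE /(_ I) /= sE _.
by rewrite sE axE mulrDl mulrA.
Qed.

Let dotxx (x : L) : L2_dot x x = `|x| ^+ 2.
Proof.
have x2 : (`|x|%:E `^ 2)%E = (\int[mu]_t (x t * x t)%:E)%E.
  have -> : `|x|%:E = 'N[mu]_2%:E[EFin \o (x : T -> R)]%E.
    exact: (finite_norm_fine (Lfun_of_Lspace x)).
  rewrite poweR_Lnorm//; apply: eq_integral => t _ /=.
  by rewrite -expr2 powR_mulrn// real_normK// num_real.
by rewrite /L2_dot /Rintegral -x2/= powR_mulrn.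
Qed.

HB.instance Definition _ :=
  NormedModule_isInnerProduct.Build R L dotC dotDZl dotxx.

End L2_dot.

(* A copy of R^n all of whose subsets are measurable, so that the outer measure
   construction mu_ext of the library applies to box_vol below. *)
Definition discrete_Rn (R : realType) (n : nat) : Type := 'rV[R]_n.
HB.instance Definition _ R n := Pointed.on (discrete_Rn R n).
HB.instance Definition _ R n :=
  @isMeasurable.Build default_measure_display (discrete_Rn R n)
    setT I (fun _ _ => I) (fun _ _ => I).

Section lebesgue_Rn.
Context (R : realType) (n : nat).
Local Open Scope ereal_scope.

Definition box (a b : 'rV[R]_n) : set 'rV[R]_n :=
  [set x | forall i, (a 0 i <= x 0 i <= b 0 i)%R].

(* The volume of the smallest closed box containing A (+oo if A is unbounded).
   The empty set is singled out only for the sake of n = 0, where box a b is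
   never empty. *)
Definition box_vol (A : set 'rV[R]_n) : \bar R :=
  if A == set0 then 0 else
  ereal_inf [set v | exists a b, A `<=` box a b /\
                                 v = (\prod_i (b 0 i - a 0 i))%R%:E].

(* Covering by arbitrary sets A_k, each charged the volume of its bounding box,
   amounts to covering by boxes. *)
Definition lebesgue_outer (X : set 'rV[R]_n) : \bar R :=
  ereal_inf [set \sum_(k <oo) box_vol (A k) |
             A in [set A : (set 'rV[R]_n)^nat | X `<=` \bigcup_k A k]].

Lemma box_vol0 : box_vol set0 = 0.
Proof. by rewrite /box_vol eqxx. Qed.

Lemma box_vol_ge0 (A : set 'rV[R]_n) : 0 <= box_vol A.
Proof.
rewrite /box_vol; case: ifPn => [//|/set0P[x Ax]].
apply: le_ereal_inf_tmp => _ [a [b [Aab ->]]]; rewrite lee_fin.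
apply: prodr_ge0 => i _; rewrite subr_ge0.
by have /andP[] := Aab _ Ax i; exact: le_trans.
Qed.

Let lebesgue_outerE : lebesgue_outer = @mu_ext _ (discrete_Rn R n) R box_vol.
Proof.
apply/funext => X; rewrite /lebesgue_outer /mu_ext; congr ereal_inf.
by apply/seteqP; split=> _ [A XA <-]; exists A => //; case: XA.
Qed.

Let lebesgue_outer0 : lebesgue_outer set0 = 0.
Proof.
rewrite lebesgue_outerE.
apply: mu_ext0; [exact: box_vol0|exact: box_vol_ge0].
Qed.

Let lebesgue_outer_ge0 X : 0 <= lebesgue_outer X.
Proof. by rewrite lebesgue_outerE; apply: mu_ext_ge0; exact: box_vol_ge0. Qed.

Let le_lebesgue_outer : {homo lebesgue_outer : A B / A `<=` B >-> A <= B}.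
Proof.
move=> A B AB; rewrite lebesgue_outerE.
exact: (@le_mu_ext _ (discrete_Rn R n) R box_vol A B AB).
Qed.

Let lebesgue_outer_sigma_subadditive : sigma_subadditive lebesgue_outer.
Proof.
rewrite lebesgue_outerE => A.
exact: (@mu_ext_sigma_subadditive _ (discrete_Rn R n) R box_vol box_vol_ge0 A).
Qed.

HB.instance Definition _ := isOuterMeasure.Build R 'rV[R]_n lebesgue_outer
  lebesgue_outer0 lebesgue_outer_ge0 le_lebesgue_outer
  lebesgue_outer_sigma_subadditive.

End lebesgue_Rn.

Definition lebesgue_outer_measure (R : realType) (n : nat) :
  {outer_measure set 'rV[R]_n -> \bar R} := @lebesgue_outer R n.

(* R^n with the Lebesgue (i.e. Caratheodory) measurable sets. *)
Definition Rn_lebesgue (R : realType) (n : nat) :=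
  caratheodory_type (lebesgue_outer_measure R n).
HB.instance Definition _ R n := Measurable.on (Rn_lebesgue R n).

Definition lebesgue_Rn (R : realType) (n : nat) :
    {measure set (Rn_lebesgue R n) -> \bar R} :=
  (lebesgue_outer_measure R n :
     set (caratheodory_type (lebesgue_outer_measure R n)) -> \bar R).

(* L^2(Omega): classes of functions on R^n for Lebesgue measure restricted to
   Omega. *)
Definition L2 (R : realType) (n : nat) (Omega : set (Rn_lebesgue R n))
    (mOmega : measurable Omega) : Type :=
  LspaceType2 (mrestr (lebesgue_Rn R n) mOmega).
HB.instance Definition _ R n Omega mOmega :=
  InnerProduct.copy (@L2 R n Omega mOmega)
    (LspaceType (mrestr (lebesgue_Rn R n) mOmega) (lee1n 2)).

(* A representative; only its class modulo null subsets of Omega is meaningful. *)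
Definition L2_fun (R : realType) (n : nat) (Omega : set (Rn_lebesgue R n))
    (mOmega : measurable Omega) (x : L2 mOmega) : Rn_lebesgue R n -> R :=
  (x : LspaceType2 (mrestr (lebesgue_Rn R n) mOmega)).
Coercion L2_fun : L2 >-> Funclass.

Section Hilbert_operators.
Context (R : realType) (V W : innerProductType R).

Definition weak_cvg (u : V^nat) (x : V) : Prop :=
  forall f : {linear V -> R^o}, continuous f -> f (u k) @[k --> \oo] --> f x.

Definition op_norm (A : V -> W) : R :=
  sup [set `|A h| | h in [set h | `|h| <= 1]].

Definition is_adjoint (A : V -> W) (B : W -> V) : Prop :=
  forall h w, dot (A h) w = dot h (B w).

(* A is a Frechet derivative at x of a map only considered on D, whose interior
   may be empty: the limit is taken along D. *)
Definition frechet_derivative_within (D : set V) (F : V -> W) (x : V)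
    (A : {linear V -> W}) : Prop :=
  continuous A /\
  (fun z => F z - F x - A (z - x)) =o_ (within D (nbhs x)) (fun z => z - x).

End Hilbert_operators.

Definition weakly_sequentially_closed (R : realType)
    (V W : innerProductType R) (D : set V) (F : V -> W) : Prop :=
  forall (u : V^nat) (x : V) (z : W), (forall k, D (u k)) ->
    weak_cvg u x -> weak_cvg (F \o u) z -> D x /\ F x = z.

Section sparse_regularization.
Context (R : realType) (n : nat).
Context (Omega : set (Rn_lebesgue R n)) (mOmega : measurable Omega).
Context (S : set (Rn_lebesgue R n)).
Local Notation X := (L2 mOmega).

Definition supp_sub (x : X) : Prop :=
  \forall t \ae lebesgue_Rn R n, (Omega `\` S) t -> x t = 0.

Definition norm_Splus (x : X) : R :=
  Num.sqrt (\int[lebesgue_Rn R n]_(t in S) (`|x t| ^+ 2)).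

Definition norm_Sminus (x : X) : R :=
  Num.sqrt (\int[lebesgue_Rn R n]_(t in Omega `\` S) (`|x t| ^+ 2)).

Definition norm_S (alpha : R) (x : X) : R :=
  Num.sqrt (alpha * norm_Splus x ^+ 2 + norm_Sminus x ^+ 2).

Context (Y : hilbertType R) (D : set X) (F : X -> Y).

Definition S_minimum_norm_solution (y : Y) (xstar x : X) : Prop :=
  [/\ D x, F x = y, supp_sub x &
      forall z, D z -> F z = y -> supp_sub z -> `|x - xstar| <= `|z - xstar|].

Definition tikhonov_functional (alpha : R) (ydelta : Y) (xstar x : X) : R :=
  `|F x - ydelta| ^+ 2 + norm_S alpha (x - xstar) ^+ 2.

Definition tikhonov_minimizer (alpha : R) (ydelta : Y) (xstar x : X) : Prop :=
  D x /\ forall z, D z ->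
    tikhonov_functional alpha ydelta xstar x <=
    tikhonov_functional alpha ydelta xstar z.

End sparse_regularization.

(* Main.v *)
Require Import Defs.
From mathcomp Require Import all_boot all_order all_algebra.
From mathcomp Require Import all_classical all_reals all_analysis.
From mathcomp Require Import ring lra.

Set Implicit Arguments.
Unset Strict Implicit.
Unset Printing Implicit Defensive.

Import Order.TTheory GRing.Theory Num.Theory.
Import numFieldNormedType.Exports.

Local Open Scope classical_set_scope.
Local Open Scope ring_scope.

(** Compare the minimizer $x = x_\alpha^\delta$ with $x^\dagger$. Write
    $e = x - x^\dagger$, $g = x^\dagger - x^*$, $r = |F(x) - y^\delta|$,
    $w = |\omega|$. Since $g$ lives on $S$, the penalty splits exactly:
    $|e+g|_{S,\alpha}^2 = \alpha(|e|_{S+}^2 + 2<e,g> + |g|^2) + |e|_{S-}^2$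
    ([norm_SD]), so minimality reads
    $r^2 + \alpha |e|_{S+}^2 + |e|_{S-}^2 <= \delta^2 - 2\alpha <e,g>$.
    The source condition turns $<e,g>$ into $<F'(x^\dagger)e, \omega>$, and
    $F'(x^\dagger)e$ is $F(x) - y$ up to a Taylor remainder of norm at most
    $\gamma/2 |e|^2$ ([taylor_remainder_le]). Hence
    $r^2 + \alpha |e|_{S+}^2 + |e|_{S-}^2 <= \delta^2 + 2\alpha w (r + \delta)
      + \alpha\gamma w (|e|_{S+}^2 + |e|_{S-}^2)$.
    As $\gamma w < 1$, the last term is absorbed on the left once
    $\alpha <= 1$, and completing the square in $r$ bounds
    $r - \alpha w$, $(\alpha(1-\gamma w))^{1/2} |e|_{S+}$ and
    $(1-\gamma w)^{1/2} |e|_{S-}$ by $\delta + \alpha w = O(\delta)$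
    ([complete_square_bounds], [tikhonov_error_bounds]).

    The Taylor estimate is available only for $|e| < \rho$. Minimality alone
    gives $\limsup |x - x^*| <= |g|$ as $\delta \to 0$
    ([minimizer_dist_sqr]), so $|e| <= |x - x^*| + |g| < \rho$ for small
    $\delta$, because $\rho > 2|g|$. *)

(** * Inner products and operator norms *)

Section inner_product.
Context (R : realType) (V : innerProductType R).
Implicit Types x y z : V.

Lemma dotDl x y z : dot (x + y) z = dot x z + dot y z.
Proof. by rewrite -{1}[x]scale1r dotDZl mul1r. Qed.

Lemma dot0l z : dot 0 z = 0.
Proof. by apply: (addrI (dot 0 z)); rewrite -dotDl !addr0. Qed.

Lemma dotZl a x z : dot (a *: x) z = a * dot x z.
Proof. by rewrite -[a *: x]addr0 dotDZl dot0l addr0. Qed.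

Lemma dotNl x z : dot (- x) z = - dot x z.
Proof. by rewrite -scaleN1r dotZl mulN1r. Qed.

Lemma dotBl x y z : dot (x - y) z = dot x z - dot y z.
Proof. by rewrite dotDl dotNl. Qed.

Lemma normD_sqr x y : `|x + y| ^+ 2 = `|x| ^+ 2 + 2 * dot x y + `|y| ^+ 2.
Proof.
rewrite -!dotxx dotDl [dot x (x + y)]dotC [dot y (x + y)]dotC !dotDl.
by rewrite [dot y x]dotC; ring.
Qed.

Lemma dot_le_norm x y : dot x y <= `|x| * `|y|.
Proof.
have [->|x0] := eqVneq x 0; first by rewrite dot0l normr0 mul0r.
have [->|y0] := eqVneq y 0; first by rewrite dotC dot0l normr0 mulr0.
have xy0 : 0 < `|x| * `|y| by rewrite mulr_gt0 ?normr_gt0.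
have := sqr_ge0 `| `|y| *: x + (- `|x|) *: y|.
rewrite normD_sqr !normrZ dotZl [dot x _]dotC dotZl [dot y x]dotC.
rewrite !normrN !normr_id => h.
rewrite -(ler_pM2l xy0); nra.
Qed.

Lemma normr_dot_le x y : `|dot x y| <= `|x| * `|y|.
Proof.
by rewrite ler_norml dot_le_norm andbT lerNl -dotNl -(normrN x) dot_le_norm.
Qed.

End inner_product.

(** Continuity matters: it makes the set in the definition of [op_norm] bounded,
    so that its supremum is not the default value. *)
Lemma op_norm_ge (R : realType) (V W : innerProductType R)
    (A : {linear V -> W}) (h : V) :
  continuous A -> `|A h| <= op_norm A * `|h|.
Proof.
move=> cA.
have [M [_ Mb]] := (linear_boundedP A).1 (continuous_linear_bounded 0 (cA 0)).
have {Mb} M1 : forall u, `|A u| <= (M + 1) * `|u| by apply: Mb; rewrite ltrDl.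
have ub : has_ubound [set `|A u| | u in [set u : V | `|u| <= 1]].
  exists (Num.max (M + 1) 0) => _ [u /= u1 <-].
  apply: le_trans (M1 u) _; rewrite le_max.
  have [M0|M0] := leP 0 (M + 1).
    by rewrite (le_trans (ler_wpM2l M0 u1)) ?mulr1.
  by rewrite orbC mulr_le0_ge0 // ltW.
have [->|h0] := eqVneq h 0; first by rewrite linear0 !normr0 mulr0.
have nh : 0 < `|h| by rewrite normr_gt0.
rewrite -ler_pdivrMr //; apply: ub_le_sup => //.
exists (`|h|^-1 *: h) => /=.
  by rewrite normrZ normfV normr_id mulVf // gt_eqF.
by rewrite linearZ /= normrZ normfV normr_id mulrC.
Qed.

(** * The Taylor remainder along a convex domain *)

(** The mean value theorem for $f(t) - k t^2$, whose derivative is nonpositive.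
    Differentiability is required relative to the segment only, endpoints
    included: this is what a derivative within a convex domain provides, and it
    also yields the continuity at 0 and 1. *)
Lemma mean_value_quadratic (R : realType) (f df : R -> R) (k : R) :
  (forall t : R, 0 <= t <= 1 -> forall eps : R, 0 < eps -> \forall s \near t,
     0 <= s <= 1 -> `|f s - f t - (s - t) * df t| <= eps * `|s - t|) ->
  (forall t : R, 0 < t < 1 -> df t <= 2 * k * t) ->
  f 1 - f 0 <= k.
Proof.
move=> fdf dfk.
pose g (t : R) := f t - k * t ^+ 2.
have dg (t : R) : t \in `]0, 1[%R -> is_derive t 1 g (df t - k * (2 * t)).
  rewrite in_itv /= => /andP[t0 t1].
  have fE : is_derive t 1 f (df t).
    suff h : h^-1 *: (f (h *: (1 : R^o) + t) - f t) @[h --> 0^'] --> df t.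
      apply: DeriveDef; first by apply/cvg_ex; exists (df t).
      exact/cvg_lim.
    apply/cvgrPdist_le => eps eps0.
    have t01 : 0 <= t <= 1 by rewrite !ltW.
    have [r /= r0 rP] := fdf t t01 eps eps0.
    have hlt (c : R) : 0 < c -> \forall h \near 0^', `|h : R| < c.
      by move=> c0; apply: dnbhs0_lt.
    near=> h.
    have h0 : h != 0 by near: h; exact: nbhs_dnbhs_neq.
    have := rP (h *: (1 : R^o) + t).
    rewrite /= /GRing.scale /= mulr1 opprD addrCA subrr addr0 normrN.
    have -> : h + t - t = h by ring.
    have hr : `|h| < r by near: h; exact: hlt.
    have ht : `|h| < t by near: h; exact: hlt.
    have ht1 : `|h| < 1 - t by near: h; apply: hlt; rewrite subr_gt0.
    move/(_ hr) => H.
    have {}H : `|f (h + t) - f t - h * df t| <= eps * `|h|.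
      by apply: H; move: ht ht1; rewrite !ltr_norml => /andP[? ?] /andP[? ?]; lra.
    have hE : f (h + t) - f t - h * df t =
              (h^-1 * (f (h + t) - f t) - df t) * h by field.
    by move: H; rewrite hE normrM ler_pM2r ?normr_gt0 // distrC.
  have kE : is_derive t 1 (fun s : R => k * s ^+ 2) (k * (2 * t)).
    apply: is_derive_eq.
    by rewrite /GRing.scale /=; ring.
  exact: is_deriveB.
have cg : {within `[0, 1], continuous g}.
  apply/subspace_continuousP => t; rewrite /= in_itv /= => t01.
  apply: cvgB; last first.
    apply: cvg_within_filter.
    by apply: cvgM; [exact: cvg_cst|exact: exprn_continuous].
  apply/cvgrPdist_le => eps eps0.
  have [r /= r0 rP] := fdf t t01 1 ltr01.
  have df0 : 0 < 1 + `|df t| by rewrite ltr_wpDr.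
  have st (c : R) : 0 < c -> \forall s \near t, `|s - t| < c.
    by move=> c0; near=> u; rewrite distrC; near: u; exact: nbhsx_ballx.
  rewrite near_withinE; near=> s.
  rewrite /= in_itv /= => s01.
  have sr : `|s - t| < r by near: s; exact: st.
  have se : `|s - t| < eps / (1 + `|df t|) by near: s; apply: st; exact: divr_gt0.
  have /(_ _ s01) := rP s; rewrite /= distrC mul1r => /(_ sr) H.
  move: se; rewrite ltr_pdivlMr // => se.
  rewrite distrC -(subrK ((s - t) * df t) (f s - f t)).
  apply: le_trans (ler_normD _ _) _; rewrite normrM.
  by apply: le_trans (ltW se); rewrite mulrDr mulr1 lerD2r.
have [c c01 gE] := MVT ltr01 dg cg.
have : df c - k * (2 * c) <= 0.
  by rewrite subr_le0 mulrCA mulrA dfk //; move: c01; rewrite in_itv.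
by move: gE; rewrite /g; nra.
Unshelve. all: by end_near. Qed.

(** The vector-valued estimate reduces to the scalar mean value theorem by pairing
    $F(x + t e) - t F'(x) e$ with the remainder $r$ itself: this gives
    $|r|^2 <= \gamma/2 |e|^2 |r|$. *)
Lemma taylor_remainder_le (R : realType) (V W : innerProductType R)
    (D : set V) (F : V -> W) (F' : V -> {linear V -> W}) (x z : V) (gamma : R) :
  convex_set (D : set (convex_lmodType V)) -> D x -> D z ->
  (forall u, D u -> frechet_derivative_within D F u (F' u)) ->
  (forall u, D u -> `|u - x| <= `|z - x| ->
     op_norm (F' x \- F' u) <= gamma * `|u - x|) ->
  0 <= gamma -> `|F z - F x - F' x (z - x)| <= gamma / 2 * `|z - x| ^+ 2.
Proof.
move=> Dconv Dx Dz dF LF gamma0; set e := z - x; set r := _ - F' x e.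
pose p (t : R) := x + t *: e.
have Dp t : 0 <= t <= 1 -> D (p t).
  move=> /andP[t0 t1].
  have := Dconv z x (Itv01 t0 t1) (mem_set Dz) (mem_set Dx).
  rewrite inE; congr D.
  rewrite /p /e /conv /= scalerBr scalerBl scale1r.
  by rewrite addrCA addrC.
have pB s t : p s - p t = (s - t) *: e.
  by rewrite /p opprD addrACA subrr add0r scalerBl.
have dfr : `|r| ^+ 2 <= gamma / 2 * `|e| ^+ 2 * `|r|.
  have -> : `|r| ^+ 2 = dot (F (p 1) - 1 *: F' x e) r -
                        dot (F (p 0) - 0 *: F' x e) r.
    rewrite -dotxx -dotBl /p scale1r !scale0r addr0 subr0 scale1r [x + e]addrC.
    by rewrite subrK addrAC.
  apply: (@mean_value_quadratic _ (fun t => dot (F (p t) - t *: F' x e) r)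
    (fun t => dot (F' (p t) e - F' x e) r)) => [t t01 eps eps0|t /andP[t0 t1]].
    have er0 : 0 < `|e| * `|r| + 1 by rewrite ltr_wpDl // mulr_ge0.
    have [_ /eqoP /(_ _ (divr_gt0 eps0 er0))] := dF _ (Dp t t01).
    rewrite near_withinE => dFt.
    have cp : p s @[s --> t] --> p t.
      apply: cvgD; first exact: cvg_cst.
      by apply: (@cvgZr_tmp _ _ _ _ _ id); exact: cvg_id.
    near=> s => s01.
    have : D (p s) -> `|F (p s) - F (p t) - F' (p t) (p s - p t)| <=
                      eps / (`|e| * `|r| + 1) * `|p s - p t|.
      by near: s; exact: cp dFt.
    move/(_ (Dp s s01)).
    rewrite pB normrZ => H.
    rewrite -dotBl -dotZl -dotBl.
    set a := (X in dot X r).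
    have -> : a = F (p s) - F (p t) - F' (p t) ((s - t) *: e).
      rewrite /a [F' (p t) (_ *: _)]linearZ /= opprD addrACA -opprD -scalerBl.
      by rewrite -[LHS]addrA -opprD -scalerDr [F' x e + _]addrC subrK.
    apply: le_trans (normr_dot_le _ _) _.
    apply: le_trans (ler_wpM2r (normr_ge0 r) H) _.
    rewrite -!mulrA ler_pM2l //.
    by rewrite ler_pdivrMl //; have := normr_ge0 (s - t); nra.
  have pt : 0 <= t <= 1 by rewrite !ltW.
  have pxE : p t - x = t *: e by rewrite /p addrAC subrr add0r.
  have pxn : `|p t - x| = t * `|e| by rewrite pxE normrZ gtr0_norm.
  have h1 : `|F' (p t) e - F' x e| <= gamma * (t * `|e|) * `|e|.
    have cA : continuous (F' x \- F' (p t)).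
      have [cx _] := dF _ Dx; have [cpt _] := dF _ (Dp _ pt).
      by move=> u; exact: cvgB (cx u) (cpt u).
    rewrite distrC; apply: le_trans (op_norm_ge e cA) _.
    apply: ler_wpM2r => //; rewrite -pxn; apply: LF; first exact: Dp.
    by rewrite pxn ler_piMl // ltW.
  apply: le_trans (dot_le_norm _ _) _.
  by apply: le_trans (ler_wpM2r (normr_ge0 r) h1) _; lra.
have [->|r0] := eqVneq r 0.
  by rewrite normr0 !mulr_ge0.
by move: dfr; rewrite expr2 ler_pM2r // normr_gt0.
Unshelve. all: by end_near. Qed.

(** * The seminorms on $S$ and on its complement *)

Section L2_support.
Context (R : realType) (n : nat).
Context (Omega : set (Rn_lebesgue R n)) (mOmega : measurable Omega).
Context (S : set (Rn_lebesgue R n)) (mS : measurable S) (SOmega : S `<=` Omega).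
Local Notation lambda := (lebesgue_Rn R n).
Local Notation X := (L2 mOmega).
Implicit Types u g : X.

Lemma Rintegral_mrestr (E : set (Rn_lebesgue R n)) (f : Rn_lebesgue R n -> R) :
  E `<=` Omega ->
  \int[mrestr lambda mOmega]_(t in E) f t = \int[lambda]_(t in E) f t.
Proof.
move=> EO; congr fine; apply: eq_measure_integral => A mA AE.
by rewrite /mrestr; congr (lambda _); apply/setIidl; exact: subset_trans EO.
Qed.

Lemma L2_sqr_integrable u :
  (mrestr lambda mOmega).-integrable setT (EFin \o (fun t => `|u t| ^+ 2)).
Proof.
have := L2_mul_integrable u u; congr (_.-integrable _ _).
by apply/funext => t /=; rewrite real_normK ?num_real.
Qed.

Lemma norm_Splus_Sminus u :
  `|u| ^+ 2 = norm_Splus S u ^+ 2 + norm_Sminus S u ^+ 2.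
Proof.
have sq (E : set (Rn_lebesgue R n)) : 0 <= \int[lambda]_(t in E) (`|u t| ^+ 2).
  by apply: Rintegral_ge0 => t _; exact: sqr_ge0.
rewrite /norm_Splus /norm_Sminus !sqr_sqrtr // -!Rintegral_mrestr //.
have -> : `|u| ^+ 2 = \int[mrestr lambda mOmega]_t (`|u t| ^+ 2).
  rewrite -dotxx; apply: eq_Rintegral => t _.
  by rewrite real_normK ?num_real.
have iu E : measurable E ->
    (mrestr lambda mOmega).-integrable E (EFin \o (fun t => `|u t| ^+ 2)).
  by move=> mE; apply: (integrableS measurableT) => //; exact: L2_sqr_integrable.
have mOS : measurable (Omega `\` S) by exact: measurableD.
(* The complement of Omega is null for the restricted measure. *)
rewrite /Rintegral (negligible_integral (measurableC mOmega)) //;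
  [|exact: L2_sqr_integrable|]; last first.
  by rewrite -[LHS]/(lambda (~` Omega `&` Omega)) setICl measure0.
rewrite setTD setCK.
have := @Rintegral_setU _ _ _ (mrestr lambda mOmega) _ _
  (fun t => `|u t| ^+ 2) mS mOS.
rewrite (setDUK SOmega); apply; first exact: iu.
by rewrite disj_set2E setDIK.
Qed.

(** A null set for the restricted measure is arbitrary outside $\Omega$, whence the
    guard in the conclusion. *)
Lemma ae_mrestr (P : set (Rn_lebesgue R n)) :
  (\forall t \ae mrestr lambda mOmega, P t) ->
  \forall t \ae lambda, Omega t -> P t.
Proof.
move=> [N [mN N0 NP]]; exists (N `&` Omega); split => //.
  exact: measurableI.
move=> t /= /not_implyP[Ot Pt]; split => //; exact: NP.
Qed.

Lemma L2_addE u g : \forall t \ae lambda, Omega t -> L2_fun (u + g) t = u t + g t.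
Proof.
by apply: ae_mrestr; apply: filterS (Lspace_addE u g) => t /(_ I).
Qed.

Lemma L2_oppE u : \forall t \ae lambda, Omega t -> L2_fun (- u) t = - u t.
Proof.
rewrite -scaleN1r.
apply: ae_mrestr; apply: filterS (Lspace_scaleE (-1) u) => t /(_ I) /= uE.
by apply: (etrans uE); rewrite mulN1r.
Qed.

Lemma supp_subB u g : supp_sub S u -> supp_sub S g -> supp_sub S (u - g).
Proof.
move=> su sg; have := L2_addE u (- g); have := L2_oppE g.
apply: filterS3 (filterI su sg) => t [u0 g0] gN uB OS; have [Ot _] := OS.
by rewrite (uB Ot) (gN Ot) u0 // g0 // subr0.
Qed.

Lemma norm_SminusD u g : supp_sub S g -> norm_Sminus S (u + g) = norm_Sminus S u.
Proof.
move=> sg; congr Num.sqrt; congr fine.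
apply: ae_eq_integral => //.
- exact: measurableD.
- apply: (measurable_funS measurableT) => //.
  exact: measurable_int (L2_sqr_integrable (u + g)).
- apply: (measurable_funS measurableT) => //.
  exact: measurable_int (L2_sqr_integrable u).
have := L2_addE u g; move: sg; apply: filterS2 => t g0 uD OS.
by rewrite (uD OS.1) g0 // addr0.
Qed.

End L2_support.

(** * Error bounds for a fixed regularization parameter *)

(** Moving the $q$-terms to the left leaves $(1 - \alpha q) b^2 >= (1 - q) b^2$
    because $\alpha <= 1$; then the sum of $(r - \alpha w)^2$,
    $\alpha (1-q) a^2$ and $(1-q) b^2$ is at most $(d + \alpha w)^2$. *)
Lemma complete_square_bounds (R : realFieldType) (a b r d al w q : R) :
  0 <= d -> 0 <= al <= 1 -> 0 <= w -> 0 <= q < 1 ->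
  r ^+ 2 + al * a ^+ 2 + b ^+ 2 <=
    d ^+ 2 + 2 * al * w * (r + d) + al * q * (a ^+ 2 + b ^+ 2) ->
  [/\ r <= d + 2 * al * w,
      al * (1 - q) * a ^+ 2 <= (d + al * w) ^+ 2 &
      (1 - q) * b ^+ 2 <= (d + al * w) ^+ 2].
Proof.
move=> d0 /andP[al0 al1] w0 /andP[q0 q1] H.
have q10 : 0 <= 1 - q by rewrite subr_ge0 ltW.
have A : 0 <= al * (1 - q) * a ^+ 2.
  exact: mulr_ge0 (mulr_ge0 al0 q10) (sqr_ge0 a).
have B : 0 <= (1 - q) * b ^+ 2 by exact: mulr_ge0 q10 (sqr_ge0 b).
have B' : 0 <= (1 - al) * q * b ^+ 2 
  by apply: mulr_ge0 (sqr_ge0 b); rewrite mulr_ge0 // subr_ge0.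
have alw : 0 <= al * w by rewrite mulr_ge0.
have C : (r - al * w) ^+ 2 + al * (1 - q) * a ^+ 2 + (1 - q) * b ^+ 2 <=
         (d + al * w) ^+ 2 by nra.
have Q := sqr_ge0 (r - al * w).
split; [|by lra|by lra].
have : `|r - al * w| ^+ 2 <= (d + al * w) ^+ 2.
  by rewrite real_normK ?num_real //; lra.
rewrite ler_pXn2r ?nnegrE ?addr_ge0 //.
by have := ler_norm (r - al * w); lra.
Qed.

Section error_bounds.
Context (R : realType) (n : nat).
Context (Omega : set (Rn_lebesgue R n)) (mOmega : measurable Omega).
Context (S : set (Rn_lebesgue R n)) (mS : measurable S) (SOmega : S `<=` Omega).
Local Notation X := (L2 mOmega).

(** The $S^-$ part does not see $g$, so the $S^+$ part of $u + g$ is obtained from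
    the full norms, and the cross term is the inner product of the whole space. *)
Lemma norm_SD (al : R) (u g : X) : 0 <= al -> supp_sub S g ->
  norm_S S al (u + g) ^+ 2 =
    al * (norm_Splus S u ^+ 2 + 2 * dot u g + `|g| ^+ 2) + norm_Sminus S u ^+ 2.
Proof.
move=> al0 sg; rewrite /norm_S sqr_sqrtr; last first.
  by rewrite addr_ge0 ?(mulr_ge0 _ (sqr_ge0 _)) ?sqr_ge0.
have := norm_Splus_Sminus mS SOmega (u + g).
have := norm_Splus_Sminus mS SOmega u.
by rewrite norm_SminusD // normD_sqr => uE ugE; congr (_ * _ + _); lra.
Qed.

Lemma norm_S_supp (al : R) (g : X) : 0 <= al -> supp_sub S g ->
  norm_S S al g ^+ 2 = al * `|g| ^+ 2.
Proof.
move=> al0 sg; rewrite -[g]add0r norm_SD // add0r dot0l.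
have := norm_Splus_Sminus mS SOmega (0 : X); rewrite normr0 expr0n /= => z.
have p := sqr_ge0 (norm_Splus S (0 : X)).
have m := sqr_ge0 (norm_Sminus S (0 : X)).
have -> : norm_Splus S (0 : X) ^+ 2 = 0 by lra.
have -> : norm_Sminus S (0 : X) ^+ 2 = 0 by lra.
by ring.
Qed.

Context (Y : hilbertType R) (D : set X) (F : X -> Y).
Context (xstar xdag x : X) (y yd : Y) (al d : R).
Context (d0 : 0 <= d) (al0 : 0 < al).
Context (noise : `|y - yd| <= d).
Context (Dxdag : D xdag) (Fxdag : F xdag = y).
Context (supp_g : supp_sub S (xdag - xstar)).
Context (x_min : tikhonov_minimizer S D F al yd xstar x).

Lemma tikhonov_le :
  `|F x - yd| ^+ 2 + norm_S S al (x - xstar) ^+ 2 <=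
  d ^+ 2 + al * `|xdag - xstar| ^+ 2.
Proof.
have [_ /(_ xdag Dxdag)] := x_min; rewrite /tikhonov_functional Fxdag => H.
apply: le_trans H _; rewrite (norm_S_supp (ltW al0) supp_g) lerD2r.
by rewrite lerXn2r ?nnegrE.
Qed.

(** Divided by $\alpha \sim \delta$, the right-hand side tends to
    $|x^\dagger - x^*|^2$: this keeps the minimizers in the ball where the
    derivative is Lipschitz. *)
Lemma minimizer_dist_sqr :
  al * `|x - xstar| ^+ 2 <= (1 + al) * (d ^+ 2 + al * `|xdag - xstar| ^+ 2).
Proof.
have := tikhonov_le; rewrite /norm_S sqr_sqrtr; last first.
  by rewrite addr_ge0 ?(mulr_ge0 _ (sqr_ge0 _)) ?sqr_ge0 // ltW.
rewrite (norm_Splus_Sminus mS SOmega (x - xstar)).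
have p := sqr_ge0 (norm_Splus S (x - xstar)).
have m := sqr_ge0 (norm_Sminus S (x - xstar)).
have r := sqr_ge0 `|F x - yd|.
set P := norm_Splus _ _ ^+ 2 in p *; set M := norm_Sminus _ _ ^+ 2 in m *.
set B := _ + al * `|_| ^+ 2 => H.
have aP : 0 <= al * P by rewrite mulr_ge0 // ltW.
have PB : al * P <= B by lra.
have MB : M <= B by lra.
have : al * M <= al * B by rewrite ler_pM2l.
by lra.
Qed.

Context (A : {linear X -> Y}) (B : Y -> X) (omega : Y) (gamma : R).
Context (AB : is_adjoint A B).
Context (source : xdag - xstar = B omega).
Context (gamma0 : 0 <= gamma) (gamma_omega : gamma * `|omega| < 1).
Context (al1 : al <= 1).
Context (taylor :
  `|F x - F xdag - A (x - xdag)| <= gamma / 2 * `|x - xdag| ^+ 2).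

Lemma tikhonov_error_bounds :
  [/\ `|F x - y| <= 2 * (d + al * `|omega|),
      al * (1 - gamma * `|omega|) * norm_Splus S (x - xdag) ^+ 2 <=
        (d + al * `|omega|) ^+ 2 &
      (1 - gamma * `|omega|) * norm_Sminus S (x - xdag) ^+ 2 <=
        (d + al * `|omega|) ^+ 2].
Proof.
set e := x - xdag; set g := xdag - xstar; set w := `|omega|.
have w0 : 0 <= w by exact: normr_ge0.
have resid : `|F x - y| <= `|F x - yd| + d.
  by apply: le_trans (ler_distD yd _ _) _; rewrite lerD2l distrC.
(* The source condition replaces g by omega, and F x - y, up to the Taylor
   remainder, replaces the derivative. *)
have cross : - dot e g <= w * (`|F x - yd| + d) + gamma / 2 * w * `|e| ^+ 2.
  have -> : - dot e g = dot (y - F x) omega + dot (F x - F xdag - A e) omega.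
    by rewrite /g source -AB -dotDl Fxdag addrA subrKA subrr sub0r dotNl.
  have h1 := dot_le_norm (y - F x) omega.
  have h2 := dot_le_norm (F x - F xdag - A e) omega.
  have h3 := ler_wpM2r w0 taylor.
  have h4 := ler_wpM2r w0 resid.
  rewrite distrC in h1; rewrite -/w -/e in h1 h2 h3 h4.
  by lra.
have := tikhonov_le.
have -> : x - xstar = e + g by rewrite /e /g addrA subrK.
rewrite (norm_SD _ (ltW al0) supp_g) -/g.
have cross' : al * (- dot e g) <=
    al * (w * (`|F x - yd| + d) + gamma / 2 * w * `|e| ^+ 2).
  by rewrite ler_pM2l.
have eE := norm_Splus_Sminus mS SOmega e.
move=> main.
have [] := @complete_square_bounds R (norm_Splus S e) (norm_Sminus S e)
  `|F x - yd| d al w (gamma * w) d0 _ w0 _ _.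
- by rewrite ltW.
- by rewrite mulr_ge0.
- by rewrite eE in cross'; lra.
by move=> h1 h2 h3; split => //; lra.
Qed.

End error_bounds.

(** * Convergence rates *)

Lemma le_divr_sqrt (R : rcfType) (c p m : R) :
  0 < c -> 0 <= m -> c * p ^+ 2 <= m ^+ 2 -> p <= (Num.sqrt c)^-1 * m.
Proof.
move=> c0 m0; have s0 : 0 < Num.sqrt c by rewrite sqrtr_gt0.
rewrite -{1}[c](sqr_sqrtr (ltW c0)) -exprMn => H.
rewrite ler_pdivlMl //; apply: le_trans (ler_norm _) _.
by rewrite -(@ler_pXn2r _ 2%N) ?nnegrE // real_normK ?num_real.
Qed.

Theorem theoremA4 (R : realType) (n : nat)
  (Omega : set (Rn_lebesgue R n)) (mOmega : measurable Omega)
  (bOmega : bounded_set (Omega : set 'rV[R]_n))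
  (S : set (Rn_lebesgue R n)) (mS : measurable S) (SOmega : S `<=` Omega)
  (Y : hilbertType R)
  (D : set (L2 mOmega)) (F : L2 mOmega -> Y)
  (F_continuous : {within D, continuous F})
  (F_closed : weakly_sequentially_closed D F)
  (xstar : L2 mOmega) (xstar_supp : supp_sub S xstar)
  (y : Y) (y_attained : exists x, [/\ D x, F x = y & supp_sub S x])
  (D_convex : convex_set (D : set (convex_lmodType (L2 mOmega))))
  (ydelta : R -> Y)
  (ydelta_noise : forall delta, 0 < delta -> `|y - ydelta delta| <= delta)
  (xdag : L2 mOmega)
  (xdag_min : S_minimum_norm_solution S D F y xstar xdag)
  (F' : L2 mOmega -> {linear L2 mOmega -> Y})
  (F'_derivative : forall x, D x -> frechet_derivative_within D F x (F' x))
  (gamma rho : R) (gamma_ge0 : 0 <= gamma)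
  (rho_large : 2 * `|xdag - xstar| < rho)
  (F'_lipschitz : forall x, D x -> `|x - xdag| < rho ->
     op_norm (F' xdag \- F' x) <= gamma * `|xdag - x|)
  (F'adj : Y -> L2 mOmega) (F'adj_adjoint : is_adjoint (F' xdag) F'adj)
  (omega : Y) (source_condition : xdag - xstar = F'adj omega)
  (gamma_omega : gamma * `|omega| < 1)
  (alpha : R -> R) (c1 c2 : R) (c1_gt0 : 0 < c1) (c2_gt0 : 0 < c2)
  (alpha_delta : forall delta, 0 < delta ->
     c1 * delta <= alpha delta <= c2 * delta)
  (xdelta : R -> L2 mOmega)
  (xdelta_min : forall delta, 0 < delta ->
     tikhonov_minimizer S D F (alpha delta) (ydelta delta) xstar (xdelta delta)) :
  [/\ (fun delta => norm_Splus S (xdelta delta - xdag))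
        =O_ (0^'+) (fun delta => Num.sqrt delta),
      (fun delta => norm_Sminus S (xdelta delta - xdag))
        =O_ (0^'+) (fun delta => delta) &
      (fun delta => F (xdelta delta) - y) =O_ (0^'+) (fun delta => delta)].
Proof.
have [Dxdag Fxdag sdag _] := xdag_min.
have sg : supp_sub S (xdag - xstar) by exact: supp_subB.
set g := `|xdag - xstar|; set w := `|omega|; set q := gamma * w.
have g0 : 0 <= g by exact: normr_ge0.
have w0 : 0 <= w by exact: normr_ge0.
have q1 : 0 < 1 - q by rewrite subr_gt0.
have gap : 0 < (rho - g) ^+ 2 - g ^+ 2.
  have gr : g < rho - g by move: rho_large; rewrite -/g; lra.
  by rewrite subr_gt0 ltr_pXn2r ?nnegrE // (le_trans g0) // ltW.
(* For delta <= 1, the minimizer satisfies |x - xstar|^2 <= g^2 + delta * K. *)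
pose K := (1 + c2) * c1^-1 + c2 * g ^+ 2.
have K0 : 0 <= K by rewrite addr_ge0 ?mulr_ge0 ?addr_ge0 ?sqr_ge0 ?invr_ge0 // ltW.
have bounds : \forall delta \near (0 : R)^'+, 0 < delta /\
    [/\ `|F (xdelta delta) - y| <= 2 * (1 + c2 * w) * delta,
        c1 * (1 - q) * norm_Splus S (xdelta delta - xdag) ^+ 2 <=
          (1 + c2 * w) ^+ 2 * delta &
        (1 - q) * norm_Sminus S (xdelta delta - xdag) ^+ 2 <=
          ((1 + c2 * w) * delta) ^+ 2].
  near=> delta.
  have d0 : 0 < delta by near: delta; exact: nbhs_right_gt.
  have d1 : delta <= 1 by near: delta; exact: nbhs_right_ltW.
  have dc : delta < c2^-1 by near: delta; apply: nbhs_right_lt; rewrite invr_gt0.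
  have dK : delta < ((rho - g) ^+ 2 - g ^+ 2) / (K + 1).
    by near: delta; apply: nbhs_right_lt; rewrite divr_gt0 // ltr_wpDl.
  split => //.
  have /andP[a1 a2] := alpha_delta _ d0.
  have al0 : 0 < alpha delta by apply: lt_le_trans a1; exact: mulr_gt0.
  have al1 : alpha delta <= 1.
    apply: le_trans a2 _; apply: ltW.
    by move: dc; rewrite -(ltr_pM2l c2_gt0) mulfV // gt_eqF.
  have xmin := xdelta_min _ d0.
  set x := xdelta delta in xmin *.
  have noise := ydelta_noise _ d0.
  have near_xdag : `|x - xdag| < rho.
    have dist := minimizer_dist_sqr mS SOmega (ltW d0) al0 noise Dxdag Fxdag sg xmin.
    rewrite -/g in dist.
    have dal : delta <= c1^-1 * alpha delta by rewrite ler_pdivlMl.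
    have dist1 : `|x - xstar| ^+ 2 <= (1 + alpha delta) * (delta * c1^-1 + g ^+ 2).
      rewrite -(ler_pM2l al0); apply: le_trans dist _.
      rewrite [leRHS]mulrCA; apply: ler_wpM2l; first by rewrite addr_ge0 // ltW.
      by rewrite mulrDr lerD2r expr2 mulrCA ler_pM2l // mulrC.
    have dist2 : `|x - xstar| ^+ 2 <= g ^+ 2 + delta * K.
      apply: le_trans dist1 _.
      have ic1 : 0 <= c1^-1 by rewrite invr_ge0 ltW.
      have h0 : 0 <= delta * c1^-1 + g ^+ 2.
        by rewrite addr_ge0 ?sqr_ge0 // mulr_ge0 // ltW.
      have h1 : (1 + alpha delta) * (delta * c1^-1 + g ^+ 2) <=
                (1 + c2 * delta) * (delta * c1^-1 + g ^+ 2).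
        by rewrite ler_wpM2r // lerD2l.
      have h2 : c2 * delta * (delta * c1^-1) <= c2 * (delta * c1^-1).
        by rewrite ler_wpM2r ?mulr_ge0 ?ler_piMr // ltW.
      by rewrite /K; lra.
    have dist3 : `|x - xstar| ^+ 2 < (rho - g) ^+ 2.
      apply: le_lt_trans dist2 _; rewrite -ltrBrDl.
      have K1 : 0 < K + 1 by rewrite ltr_wpDl.
      by move: dK; rewrite ltr_pdivlMr //; lra.
    have : `|x - xstar| < rho - g.
      rewrite -(@ltr_pXn2r _ 2%N) // nnegrE //.
      by move: rho_large; rewrite -/g; lra.
    rewrite ltrBrDr; apply: le_lt_trans.
    by apply: le_trans (ler_distD xstar _ _) _; rewrite lerD2l distrC.
  have taylor : `|F x - F xdag - F' xdag (x - xdag)| <=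
                gamma / 2 * `|x - xdag| ^+ 2.
    apply: taylor_remainder_le D_convex _ _ F'_derivative _ _ => //.
      by have [] := xmin.
    move=> u Du ux; rewrite distrC; apply: F'_lipschitz => //.
    exact: le_lt_trans near_xdag.
  have [h1 h2 h3] := tikhonov_error_bounds mS SOmega (ltW d0) al0 noise Dxdag
    Fxdag sg xmin F'adj_adjoint source_condition gamma_ge0 gamma_omega al1 taylor.
  rewrite -/w -/q in h1 h2 h3.
  have aw : delta + alpha delta * w <= (1 + c2 * w) * delta.
    by rewrite mulrDl mul1r lerD2l mulrAC ler_wpM2r.
  have aw2 : (delta + alpha delta * w) ^+ 2 <= ((1 + c2 * w) * delta) ^+ 2.
    by rewrite ler_pXn2r ?nnegrE ?mulr_ge0 ?addr_ge0 ?mulr_ge0 // ltW.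
  split; [by lra| |by lra].
  (* The lower bound on alpha costs one power of delta: only a rate
     sqrt delta remains for the S+ part. *)
  rewrite -(ler_pM2l d0).
  have P0 := sqr_ge0 (norm_Splus S (x - xdag)).
  have := ler_wpM2r P0 (ler_wpM2r (ltW q1) a1).
  by lra.
have C0 : 0 < 1 + c2 * w by rewrite ltr_pwDl // mulr_ge0 // ltW.
split; apply/eqO_exP.
- exists ((Num.sqrt (c1 * (1 - q)))^-1 * (1 + c2 * w)).
    by rewrite mulr_gt0 // invr_gt0 sqrtr_gt0 mulr_gt0.
  apply: filterS bounds => delta [d0 [_ h _]].
  rewrite !ger0_norm ?sqrtr_ge0 // -mulrA.
  apply: le_divr_sqrt; first exact: mulr_gt0.
    by apply: mulr_ge0; [exact: ltW|exact: sqrtr_ge0].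
  by rewrite exprMn (sqr_sqrtr (ltW d0)).
- exists ((Num.sqrt (1 - q))^-1 * (1 + c2 * w)).
    by rewrite mulr_gt0 // invr_gt0 sqrtr_gt0.
  apply: filterS bounds => delta [d0 [_ _ h]].
  rewrite ger0_norm ?sqrtr_ge0 // (gtr0_norm d0) -mulrA.
  by apply: le_divr_sqrt => //; apply: mulr_ge0; exact: ltW.
- exists (2 * (1 + c2 * w)); first exact: mulr_gt0.
  by apply: filterS bounds => delta [d0 [h _ _]]; rewrite (gtr0_norm d0).
Unshelve. all: by end_near. Qed.
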